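(* Let $C$ be an étale topological category. The map $\omega\colon C\to\mathsf{C}(\Omega(C))$, $\omega(x)=O_x$, where $O_x$ is the set of all open subsets of $C$ containing $x$, is a continuous covering functor.
   Context: Étale topological category: a small category $C$ (arrows, identities $C_o$, domain/codomain maps $\mathbf{d},\mathbf{r}$, $ab$ defined iff $\mathbf{d}(a)=\mathbf{r}(b)$) with a topology making $\mathbf{d}$, $\mathbf{r}$ and the multiplication (on composable pairs, subspace of the product) continuous, with $\mathbf{d},\mathbf{r}$ local homeomorphisms. $\Omega(C)$ is the set of open subsets of $C$ ordered by inclusion, with product $UV=\{uv:u\in U,v\in V,\mathbf{d}(u)=\mathbf{r}(v)\}$, identity $C_o$, $U^{\ast}=\mathbf{d}(U)$, $U^{+}=\mathbf{r}(U)$; it is a restriction quantal frame. For a restriction quantal frame $Q$ (with these operations), $\mathsf{C}(Q)$ is the category of completely prime filters of $Q$ (nonempty, upward closed, closed under binary meets, not containing $0$, and containing some $a_i$ whenever it contains $\bigvee_i a_i$), with $\mathbf{d}(A)=\{x:\exists a\in A,\ a^{\ast}\le x\}$, $\mathbf{r}(A)=\{x:\exists a\in A,\ a^{+}\le x\}$, $A\cdot B=\{x:\exists a\in A,b\in B,\ ab\le x\}$ defined iff $\mathbf{d}(A)=\mathbf{r}(B)$, and topology with base the sets $\mathscr{X}_a=\{A:a\in A\}$, $a$ a partial isometry ($a$ with $b\le a\Rightarrow b=b^{+}a=ab^{\ast}$). A covering functor is a functor $F$ that is $\mathbf{d}$-injective ($F(x)=F(y)$, $\mathbf{d}(x)=\mathbf{d}(y)\Rightarrow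 x=y$), $\mathbf{d}$-surjective (if $F(e)=\mathbf{d}(y)$ for an identity $e$, there is $x$ with $\mathbf{d}(x)=e$ and $F(x)=y$), and similarly $\mathbf{r}$-injective and $\mathbf{r}$-surjective. *)

(* Defs.v *)
From HB Require Import structures.
From mathcomp Require Import all_boot all_order.
From mathcomp Require Import boolp classical_sets topology.
Set Implicit Arguments. Unset Strict Implicit. Unset Printing Implicit Defensive.
Local Open Scope classical_set_scope.

Section Etale.
Variable X : topologicalType.
Variables (d r : X -> X) (mul : X -> X -> X).

(* Small category presented by its arrows: identities are the x with d x = x;
   [mul a b] is the composite ab, meaningful when d a = r b. *)
Definition is_category : Prop :=
  (forall x, d (d x) = d x) /\ (forall x, r (d x) = d x) /\
  (forall x, d (r x) = r x) /\ (forall x, r (r x) = r x) /\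
  (forall a b, d a = r b -> d (mul a b) = d b /\ r (mul a b) = r a) /\
  (forall a b c, d a = r b -> d b = r c -> mul (mul a b) c = mul a (mul b c)) /\
  (forall x, mul x (d x) = x) /\ (forall x, mul (r x) x = x).

Definition identities : set X := [set e | d e = e].

Definition local_homeo (f : X -> X) : Prop :=
  forall x, exists U : set X,
    open U /\ U x /\ open (f @` U) /\ {in U &, injective f} /\
        (forall V, open V -> V `<=` U -> open (f @` V)) /\
        {within U, continuous f}.

Definition etale_category : Prop :=
  is_category /\ continuous d /\ continuous r /\
  {within [set p : X * X | d p.1 = r p.2], continuous (fun p => mul p.1 p.2)} /\
  local_homeo d /\ local_homeo r.

(* The quantale Omega(C): elements are the open subsets of X. *)
Definition Omul (U V : set X) : set X :=
  [set z | exists u v, [/\ U u, V v, d u = r v & z = mul u v]].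
Definition Ostar (U : set X) : set X := d @` U.
Definition Oplus (U : set X) : set X := r @` U.

Definition partial_isometry (a : set X) : Prop :=
  open a /\ forall b, open b -> b `<=` a ->
    b = Omul (Oplus b) a /\ b = Omul a (Ostar b).

Definition cp_filter (F : set (set X)) : Prop :=
  (forall U, F U -> open U) /\
      (exists U, F U) /\
      (forall U V, F U -> open V -> U `<=` V -> F V) /\
      (forall U V, F U -> F V -> F (U `&` V)) /\
      ~ F set0 /\
      (forall S : set (set X), (forall U, S U -> open U) ->
          F (\bigcup_(U in S) U) -> exists2 U, S U & F U).

Definition Cd (A : set (set X)) : set (set X) :=
  [set x | open x /\ exists2 a, A a & Ostar a `<=` x].
Definition Cr (A : set (set X)) : set (set X) :=
  [set x | open x /\ exists2 a, A a & Oplus a `<=` x].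
Definition Cmul (A B : set (set X)) : set (set X) :=
  [set x | open x /\ exists a b, [/\ A a, B b & Omul a b `<=` x]].

(* topology on C(Omega(C)) with base the sets X_a, a a partial isometry:
   W is open iff every point of W lies in some basic X_a contained in W. *)
Definition C_open (W : set (set (set X))) : Prop :=
  (forall A, W A -> cp_filter A) /\
  (forall A, W A -> exists a, [/\ partial_isometry a, A a &
       forall B, cp_filter B -> B a -> W B]).

Definition omega (x : X) : set (set X) := [set U | open U /\ U x].

End Etale.

(* Main.v *)
Require Import Defs.
From HB Require Import structures.
From mathcomp Require Import all_boot all_order.
From mathcomp Require Import boolp classical_sets topology.
Local Open Scope classical_set_scope.
Set Implicit Arguments.

(* Every piece of the statement reduces to a general fact about a topological
   space X and maps f : X -> X:
   - O_x is a completely prime filter of opens (complete primeness is just the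
     definition of a union);
   - for continuous f, O_{f x} is the direct image filter of O_x along f; with
     f = d and f = r this is functoriality on identities, and the analogous
     statement for the multiplication follows from its continuity on
     composable pairs;
   - omega is continuous because each basic open X_a pulls back to a itself;
   - for a local homeomorphism f, omega is f-injective (x, y share a chart),
     and f-surjective: a completely prime filter B contains a chart U of f
     (the charts cover X), and the preimage in U of a point e whose
     neighbourhood filter is the image of B is the point x with O_x = B. *)

Section NeighbourhoodMap.
Variable X : topologicalType.

Lemma omega_cp_filter (x : X) : cp_filter (omega x).
Proof.
split; first by move=> U [].
split; first by exists setT; split => //; exact: openT.
split; first by move=> U V [_ Ux] oV UV; split => //; exact: UV.
split; first by move=> U V [oU Ux] [oV Vx]; split => //; exact: openI.
split; first by case.
move=> S oS [_ [U SU Ux]]; exists U => //; split => //; exact: oS.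
Qed.

(* The open sets containing the image under f of some member of A; for
   f = d (resp. r) this is the filter Cd d A (resp. Cr r A). *)
Definition image_filter (f : X -> X) (A : set (set X)) : set (set X) :=
  [set V | open V /\ exists2 a, A a & f @` a `<=` V].

Lemma omega_image (f : X -> X) (x : X) :
  continuous f -> omega (f x) = image_filter f (omega x).
Proof.
move=> cf; rewrite eqEsubset; split => V.
- move=> [oV Vfx]; split => //; exists (f @^-1` V).
    by split => //; move/continuousP: cf; apply.
  by move=> _ [w Vw <-].
- by move=> [oV [a [_ ax] fa]]; split => //; apply: fa; exists x.
Qed.

Lemma omega_mul (d r : X -> X) (mul : X -> X -> X) (x y : X) :
  {within [set p : X * X | d p.1 = r p.2], continuous (fun p => mul p.1 p.2)} ->
  d x = r y -> omega (mul x y) = Cmul d r mul (omega x) (omega y).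
Proof.
move=> cmul dxy; rewrite eqEsubset; split => V.
- case=> oV Vxy; split => //.
  have nV : nbhs (mul x y) V by exact: open_nbhs_nbhs.
  have := cmul ((x, y) : subspace [set p : X * X | d p.1 = r p.2]) _ nV.
  rewrite /= /nbhs /= -nbhs_subspace_in //.
  case=> -[Q R] /= [nQ nR] QR_V.
  move: nQ; rewrite nbhsE => -[a [oa ax] aQ].
  move: nR; rewrite nbhsE => -[b [ob yb] bR].
  exists a, b; split => // _ [u [v [au bv duv ->]]].
  exact: (QR_V (u, v) (conj (aQ _ au) (bR _ bv)) duv).
- by case=> oV [a [b [[_ ax] [_ yb] ab_V]]]; split => //; apply: ab_V; exists x, y.
Qed.

(* omega is continuous: a point of W lies in a basic open X_a inside W, and
   every point of the open set a is then mapped into W. *)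
Lemma omega_continuous (d r : X -> X) (mul : X -> X -> X)
    (W : set (set (set X))) :
  C_open d r mul W -> open [set x : X | W (omega x)].
Proof.
move=> [_ HW]; rewrite openE => x Wx.
have [a [_ ax XaW]] := HW _ Wx.
rewrite /interior nbhsE; exists a; first exact: ax.
move=> z az; apply: XaW; first exact: omega_cp_filter.
by split => //; case: ax.
Qed.

Definition chart (f : X -> X) (U : set X) : Prop :=
  open U /\ {in U &, injective f} /\
  (forall V, open V -> V `<=` U -> open (f @` V)).

Lemma local_homeo_chart (f : X -> X) (x : X) :
  local_homeo f -> exists2 U, chart f U & U x.
Proof. by move=> lh; have [U [oU [Ux [_ [inj [op _]]]]]] := lh x; exists U. Qed.

(* Points with the same neighbourhoods and the same image are equal: both lie
   in a chart around x, on which f is injective. *)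
Lemma omega_local_inj (f : X -> X) (x y : X) :
  local_homeo f -> omega x = omega y -> f x = f y -> x = y.
Proof.
move=> lh exy fxy; have [U [oU [inj _]] Ux] := local_homeo_chart x lh.
have [_ Uy] : omega y U by rewrite -exy.
by apply: inj; rewrite ?inE.
Qed.

Section Lifting.
Variables (f : X -> X) (B : set (set X)).
Hypothesis B_cp : cp_filter B.

(* Since the charts of a local homeomorphism cover X, complete primeness puts
   one of them in B. *)
Lemma cp_filter_chart : local_homeo f -> exists2 U, chart f U & B U.
Proof.
move=> lh; case: B_cp => _ [[U0 BU0] [B_up [_ [_ B_prime]]]].
apply: B_prime => [U [] //|].
have BT : B setT by apply: (B_up U0) => //; exact: openT.
suff -> : \bigcup_(U in chart f) U = setT by [].
apply/seteqP; split => // z _.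
by have [U cU Uz] := local_homeo_chart z lh; exists U.
Qed.

Variables (U : set X) (e : X).
Hypotheses (U_chart : chart f U) (BU : B U).
Hypothesis e_image : omega e = image_filter f B.

(* The chart U belongs to B, so its open image is a neighbourhood of e. *)
Lemma chart_covers_point : exists2 x, U x & f x = e.
Proof.
case: U_chart => oU [_ U_open_map].
have : omega e (f @` U) by rewrite e_image; split; [exact: U_open_map | exists U].
by case=> _ [x Ux fxe]; exists x.
Qed.

Lemma omega_lift (x : X) : U x -> f x = e -> omega x = B.
Proof.
move=> Ux fxe; case: U_chart => oU [inj U_open_map].
case: B_cp => B_open [_ [B_up [B_meet _]]].
rewrite eqEsubset; split => V.
- case=> oV Vx.
  have VU_open : open (V `&` U) by exact: openI.
  have : omega e (f @` (V `&` U)).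
    by split; [apply: U_open_map => // z [] | exists x].
  rewrite e_image; case=> _ [a Ba fa_VU].
  apply: (B_up (a `&` U)) => //; first exact: B_meet.
  move=> z [az Uz]; have [z' [Vz' Uz'] fz'z] := fa_VU _ (ex_intro2 _ _ z az erefl).
  by have -> : z = z' by apply: inj; rewrite ?inE.
- move=> BV; have oV := B_open _ BV.
  have : image_filter f B (f @` (V `&` U)).
    split; first by apply: U_open_map; [exact: openI | move=> z []].
    by exists (V `&` U); [exact: B_meet | ].
  rewrite -e_image; case=> _ [x' [Vx' Ux'] fx'x]; split => //.
  by have -> : x = x' by apply: inj; rewrite ?inE // fx'x fxe.
Qed.

End Lifting.

Lemma omega_local_surj (f : X -> X) (e : X) (B : set (set X)) :
  local_homeo f -> cp_filter B -> omega e = image_filter f B ->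
  exists x, f x = e /\ omega x = B.
Proof.
move=> lh B_cp e_image; have [U U_chart BU] := cp_filter_chart B_cp lh.
have [x Ux fxe] := chart_covers_point U_chart BU e_image.
by exists x; split; last exact: (omega_lift B_cp U_chart BU e_image).
Qed.

End NeighbourhoodMap.

Theorem mainTheorem15 (X : topologicalType) (d r : X -> X) (mul : X -> X -> X) :
  etale_category d r mul ->
  (forall x, @cp_filter X (omega x)) /\
  (forall x, omega (d x) = Cd d (omega x)) /\
  (forall x, omega (r x) = Cr r (omega x)) /\
  (forall x y, d x = r y -> omega (mul x y) = Cmul d r mul (omega x) (omega y)) /\
  (forall W, C_open d r mul W -> open [set x : X | W (omega x)]) /\
  (forall x y, omega x = omega y -> d x = d y -> x = y) /\
  (forall e, d e = e -> forall B, @cp_filter X B -> omega e = Cd d B ->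
     exists x, d x = e /\ omega x = B) /\
  (forall x y, omega x = omega y -> r x = r y -> x = y) /\
  (forall e, d e = e -> forall B, @cp_filter X B -> omega e = Cr r B ->
     exists x, r x = e /\ omega x = B).
Proof.
move=> [_ [cd [cr [cmul [lhd lhr]]]]].
split; first exact: omega_cp_filter.
split; first by move=> x; exact: omega_image.
split; first by move=> x; exact: omega_image.
split; first by move=> x y; exact: omega_mul.
split; first exact: omega_continuous.
split; first by move=> x y; exact: omega_local_inj.
split; first by move=> e _ B; exact: omega_local_surj.
split; first by move=> x y; exact: omega_local_inj.
by move=> e _ B; exact: omega_local_surj.
Qed.
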